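(* Let $L>N$ be nonnegative integers and consider the Bernoulli--Laplace model with $L$ sites and $N$ particles (described in the context). Let $\theta:(0,\infty)^2\to[0,\infty)$ be any weight function that is not identically $0$, symmetric, differentiable and concave. Then for all $\rho:\Omega\to(0,\infty)$ and $\psi:\Omega\to\mathbb{R}$, $$\mathscr{B}(\rho,\psi)\ \ge\ \Big(M_\theta+\frac{L}{2}\Big)\,\mathscr{A}(\rho,\psi).$$
   Context: **Bernoulli--Laplace model.** $[L]=\{1,\dots,L\}$, $\Omega=\{\eta\in\{0,1\}^{[L]}:\sum_{i=1}^L\eta_i=N\}$. Moves $G=\{\sigma_{ij}:i,j\in[L]\}$ with $\sigma_{ij}\eta=\eta-\delta_i+\delta_j$ if $\eta_i(1-\eta_j)>0$ and $\sigma_{ij}\eta=\eta$ otherwise ($\delta_i$ is the indicator of $i$). Rates $c(\eta,\sigma_{ij})=\eta_i(1-\eta_j)$; the reversible measure $m$ is uniform on $\Omega$. The generator is $\mathcal{L}\psi(\eta)=\sum_{\sigma\in G}c(\eta,\sigma)(\psi(\sigma\eta)-\psi(\eta))$, and $S=\{(\eta,\sigma)\in\Omega\times G:c(\eta,\sigma)>0\}$. $$M_\theta=\inf_{s,t>0:\ \theta(s,t)>0}\frac{\theta(s,s)+\theta(t,t)}{2\theta(s,t)}\in[0,1].$$ For $\rho:\Omega\to(0,\infty)$, $\psi:\Omega\to\mathbb{R}$: $$\mathscr{A}(\rho,\psi)=\tfrac12\sum_{(\eta,\sigma)\in S}m(\eta)c(\eta,\sigma)\,\theta(\rho(\eta),\rho(\sigma\eta))\,[\psi(\eta)-\psi(\sigma\eta)]^2,$$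 $$\mathscr{C}(\rho,\psi)=\tfrac14\sum_{(\eta,\sigma)\in S}m(\eta)c(\eta,\sigma)\Big\{\partial_1\theta(\rho(\eta),\rho(\sigma\eta))\,\mathcal{L}\rho(\eta)+\partial_2\theta(\rho(\eta),\rho(\sigma\eta))\,\mathcal{L}\rho(\sigma\eta)\Big\}[\psi(\eta)-\psi(\sigma\eta)]^2,$$ $$\mathscr{D}(\rho,\psi)=\tfrac12\sum_{(\eta,\sigma)\in S}m(\eta)c(\eta,\sigma)\,\theta(\rho(\eta),\rho(\sigma\eta))(\psi(\eta)-\psi(\sigma\eta))(\mathcal{L}\psi(\eta)-\mathcal{L}\psi(\sigma\eta)),$$ and $\mathscr{B}=\mathscr{C}-\mathscr{D}$. *)

(* Defs.v *)
From HB Require Import structures.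
From mathcomp Require Import all_boot all_order all_algebra.
From mathcomp Require Import all_classical all_reals all_analysis.
Set Implicit Arguments.
Unset Strict Implicit.
Unset Printing Implicit Defensive.
Import Order.TTheory GRing.Theory Num.Theory.
Import numFieldNormedType.Exports.
Local Open Scope classical_set_scope.
Local Open Scope ring_scope.

(* The sites 1, ..., L are represented by 'I_L = {0, ..., L - 1}. *)
Record config (L N : nat) := Config {
  occ :> {ffun 'I_L -> bool};
  _ : (\sum_(i < L) (occ i : nat))%N == N }.

Set Warnings "-redundant-canonical-projection,-projection-no-head-constant".
HB.instance Definition _ L N := [isSub for @occ L N].
HB.instance Definition _ L N := [Finite of config L N by <:].

(* The pair (i, j) stands for the move sigma_ij.  Indexing the moves by pairs
   agrees with summing over the set {sigma_ij} of maps: if 0 < N < L, the maps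
   sigma_ij with i != j are pairwise distinct and different from the identity,
   while the pairs (i, i), and all pairs if N = 0, have rate 0. *)
Notation move L := ('I_L * 'I_L)%type.

Section BernoulliLaplace.
Context {L N : nat}.
Implicit Types (eta : config L N) (g : move L).

(* The rate takes its values in nat, where eta j <= 1, so that the truncated
   subtraction is the usual one. *)
Definition rate eta g : nat := (eta g.1 * (1 - eta g.2))%N.

Definition jump_occ eta g : {ffun 'I_L -> bool} :=
  if (0 < rate eta g)%N
  then [ffun k => (eta k && (k != g.1)) || (k == g.2)] else eta.

Lemma jump_occE eta g k : (0 < rate eta g)%N ->
  jump_occ eta g k = (eta k - (k == g.1) + (k == g.2))%N :> nat.
Proof.
case: g => i j; rewrite /jump_occ => cg; rewrite cg ffunE /=.
move: cg; rewrite /rate /=.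
have [->|_] := eqVneq k i; last first.
  have [->|_] := eqVneq k j; first by case: (eta j); rewrite ?muln0.
  by case: (eta k).
have [->|_] := eqVneq i j; first by case: (eta _).
by case: (eta i).
Qed.

Lemma jump_occ_subproof eta g :
  (\sum_(k < L) (jump_occ eta g k : nat))%N == N.
Proof.
have [cg|cg] := boolP (0 < rate eta g)%N; last first.
  by rewrite /jump_occ (negbTE cg); case: eta {cg}.
rewrite (eq_bigr _ (fun k _ => jump_occE k cg)) big_split /=.
have sum1 i : (\sum_(k < L) (k == i : nat) = 1)%N.
  by rewrite (bigD1 i)//= eqxx big1 ?addn0// => k /negbTE ->.
rewrite sumnB; last first.
  move=> k _; case: (eqVneq k g.1) => // ->.
  by move: cg; rewrite /rate; case: (eta _).
rewrite !sum1 subnK; first by case: eta {cg}.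
rewrite (bigD1 g.1)//=; move: cg; rewrite /rate.
by case: (eta g.1).
Qed.

Definition jump g eta : config L N := Config (jump_occ_subproof eta g).

Context {R : realType}.
Implicit Types (theta : R * R -> R) (rho psi : config L N -> R).

Definition unif eta : R := (#|{: config L N}|%:R)^-1.

Definition gen psi eta : R :=
  \sum_(g : move L) (rate eta g)%:R * (psi (jump g eta) - psi eta).

Definition Sset : {set config L N * move L} :=
  [set x | (0 < rate x.1 x.2)%N]%SET.

Definition partial1 theta (s t : R) : R := derive1 (fun u : R => theta (u, t)) s.
Definition partial2 theta (s t : R) : R := derive1 (fun u : R => theta (s, u)) t.

Definition calA theta rho psi : R :=
  2^-1 * \sum_(x in Sset) let: (eta, g) := x in
    unif eta * (rate eta g)%:R * theta (rho eta, rho (jump g eta))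
    * (psi eta - psi (jump g eta)) ^+ 2.

Definition calC theta rho psi : R :=
  4^-1 * \sum_(x in Sset) let: (eta, g) := x in
    unif eta * (rate eta g)%:R
    * (partial1 theta (rho eta) (rho (jump g eta)) * gen rho eta
       + partial2 theta (rho eta) (rho (jump g eta)) * gen rho (jump g eta))
    * (psi eta - psi (jump g eta)) ^+ 2.

Definition calD theta rho psi : R :=
  2^-1 * \sum_(x in Sset) let: (eta, g) := x in
    unif eta * (rate eta g)%:R * theta (rho eta, rho (jump g eta))
    * (psi eta - psi (jump g eta)) * (gen psi eta - gen psi (jump g eta)).

Definition calB theta rho psi : R := calC theta rho psi - calD theta rho psi.

End BernoulliLaplace.

(* A weight function on (0, oo)^2 is encoded as a total function on R * R of
   which only the values on [posquad] matter; as [posquad] is open, this also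
   holds for its derivatives at points of [posquad]. *)
Definition posquad (R : realType) : set (R * R) :=
  [set z | 0 < z.1 /\ 0 < z.2].

Definition concave_on (R : realType) (D : set (R * R)) (f : R * R -> R) : Prop :=
  convex_function (E := (R^o * R^o)%type) D (\- f).

Definition Mtheta (R : realType) (theta : R * R -> R) : R :=
  inf [set r : R | exists s t, [/\ 0 < s, 0 < t, 0 < theta (s, t) &
    r = (theta (s, s) + theta (t, t)) / (2 * theta (s, t))]].

(* Main.v *)
(* When a move g = (i, j) is possible at eta, it exchanges the sites i and j,
   and the generator commutes with this exchange.  Hence the jumps h of eta can be
   coupled with those of g eta so that eta and g eta become h eta and its
   image under the exchange.  If h = g, the two configurations trade places; if
   h shares exactly one site with g, they merge (there are L - 2 such h);
   otherwise eta, g eta, h eta and g (h eta) form a square of commuting moves.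
   Bounding the partial derivatives of theta by its increments along the coupled
   jumps (concavity), the first two cases yield (M + L/2) A, and the squares
   contribute, after symmetrization by reversibility, a sum of nonnegative
   multiples of (psi eta - psi (g eta) - psi (h eta) + psi (g (h eta)))^2. *)

Require Import Defs.
From HB Require Import structures.
From mathcomp Require Import all_boot all_order all_algebra all_fingroup.
From mathcomp Require Import all_classical all_reals all_analysis.
From mathcomp Require Import ring lra.
Import Order.TTheory GRing.Theory Num.Theory.
Import numFieldNormedType.Exports.
Local Open Scope classical_set_scope.
Local Open Scope ring_scope.

(** * Tangent-plane and diagonal bounds for a concave weight *)

Section Weight.
Context {R : realType} (theta : R * R -> R).
Context (theta_ge0 : forall s t : R, 0 < s -> 0 < t -> 0 <= theta (s, t)).
Context (theta_diff :
  forall s t : R, 0 < s -> 0 < t -> differentiable theta (s, t)).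
Context (theta_concave : concave_on (@posquad R) theta).

Lemma diff_partials (s t u v : R) : 0 < s -> 0 < t ->
  'd theta (s, t) (u, v) = partial1 theta s t * u + partial2 theta s t * v.
Proof.
move=> s0 t0; have dth := theta_diff _ _ s0 t0.
have -> : (u, v) = u *: (1, 0) + v *: (0, 1) :> R * R.
  by congr (_, _); rewrite /= /GRing.scale/=; lra.
rewrite linearD !linearZ/= -!deriveE// /partial1 /partial2 /derive1 /derive.
rewrite /GRing.scale/= mulrC [v * _]mulrC.
congr (_ * _ + _ * _); congr (lim (_ @ 0^')); apply/funext => h /=;
  congr (_ * (theta (_, _) - _)); rewrite /= /GRing.scale/=; lra.
Qed.

(** Concavity makes every difference quotient along the segment towards [(s', t')], with step [e] in
    (0, 1], at least the full increment; letting [e] tend to 0 gives the directional derivative. *)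
Lemma concave_le_diff (s t s' t' : R) : 0 < s -> 0 < t -> 0 < s' -> 0 < t' ->
  theta (s', t') - theta (s, t) <=
  partial1 theta s t * (s' - s) + partial2 theta s t * (t' - t).
Proof.
move=> s0 t0 s'0 t'0; rewrite -diff_partials// -deriveE; last exact: theta_diff.
have cvgD : derivable theta (s, t) (s' - s, t' - t).
  by apply: diff_derivable; exact: theta_diff.
(* The segment only provides positive steps, so the derivative is taken as a right limit. *)
have cvgDr := cvg_dnbhs_at_right cvgD.
rewrite /derive -(cvg_lim _ cvgDr)//.
apply: limr_ge; first by apply/cvg_ex; eexists; exact: cvgDr.
near=> e.
have e0 : 0 < e by [].
have e1 : e <= 1 by near: e; exact: nbhs_right_le.
pose e' : {i01 R} := Itv01 (ltW e0) e1.
have := theta_concave e' (s', t') (s, t).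
rewrite !inE /posquad/= => /(_ (conj s'0 t'0) (conj s0 t0)).
have -> : conv e' ((s', t') : convex_lmodType (R^o * R^o)%type) (s, t) =
    e *: (s' - s, t' - t) + (s, t) :> R * R.
  by congr (_, _); rewrite /= /GRing.scale/= /unstable.onem; ring.
rewrite [X in _ <= X -> _](_ : _ =
  e * - theta (s', t') + (1 - e) * - theta (s, t))//.
move=> conc; rewrite /GRing.scale/= ler_pdivlMl//.
by move: conc; set p := theta (_ + _); nra.
Unshelve. all: end_near. Qed.

(** Where [theta (s, t)] vanishes the infimum gives no information, but the left side is then 0.
    Elsewhere the quotient at [(s, t)] belongs to a set bounded below by 0. *)
Lemma Mtheta_le (s t : R) : 0 < s -> 0 < t ->
  2 * Mtheta theta * theta (s, t) <= theta (s, s) + theta (t, t).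
Proof.
move=> s0 t0; have := theta_ge0 _ _ s0 t0; rewrite le_eqVlt => /predU1P[<-|th0].
  by rewrite mulr0 addr_ge0// theta_ge0.
rewrite mulrAC -ler_pdivlMl ?mulr_gt0//.
apply: ge_inf; last by exists s, t; split => //; rewrite mulrC.
exists 0 => r [s' [t' [s'0 t'0 th'0 ->]]].
by rewrite divr_ge0 ?addr_ge0 ?theta_ge0// ?mulr_ge0// ltW.
Qed.
End Weight.

(** * Site permutations, counting of moves, and reversibility *)

Section Moves.
Context {L N : nat}.
Implicit Types (eta : config L N) (g h : move L) (s : {perm 'I_L}).

Lemma permc_subproof s eta :
  (\sum_(k < L) ([ffun k => eta (s k)] k : nat))%N == N.
Proof.
under eq_bigr do rewrite ffunE.
case: eta => f /= /eqP <-; apply/eqP.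
by rewrite [RHS](reindex_inj (@perm_inj _ s)).
Qed.

Definition permc s eta : config L N := Config (permc_subproof s eta).

Lemma permcE s eta k : permc s eta k = eta (s k).
Proof. by rewrite ffunE. Qed.

Lemma configP eta eta' : eta =1 eta' -> eta = eta'.
Proof. by move=> e; apply/val_inj/ffunP. Qed.

Lemma sum_occ eta : (\sum_(k < L) eta k)%N = N.
Proof. by case: eta => f /= /eqP. Qed.

Lemma sum_vac eta : (\sum_(k < L) (1 - eta k))%N = (L - N)%N.
Proof.
rewrite -[in RHS](sum_occ eta) sumnB; last by move=> k _; case: (eta k).
by rewrite sum_nat_const card_ord muln1.
Qed.

(** Unlike [jump g], which is the identity where the rate vanishes, this relabels the sites in the
    same way for every configuration, hence is compatible with [gen]. *)
Definition swap g := permc (tperm g.1 g.2).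

Lemma swapE g eta k : swap g eta k = eta (tperm g.1 g.2 k).
Proof. exact: permcE. Qed.

Lemma swapK g : involutive (swap g).
Proof. by move=> eta; apply: configP => k; rewrite !swapE tpermK. Qed.

Lemma rateE eta g : rate eta g = eta g.1 && ~~ eta g.2 :> nat.
Proof. by rewrite /rate; case: (eta g.1); case: (eta g.2). Qed.

Lemma rate_permc s eta g : rate (permc s eta) g = rate eta (s g.1, s g.2).
Proof. by rewrite /rate !permcE. Qed.

Lemma jumpE eta g k : (0 < rate eta g)%N ->
  jump g eta k = eta k && (k != g.1) || (k == g.2).
Proof. by move=> cg; rewrite /jump /= /jump_occ cg ffunE. Qed.

Lemma jump_rate0 eta g : rate eta g = 0%N -> jump g eta = eta.
Proof. by move=> cg; apply/val_inj; rewrite /= /jump_occ cg. Qed.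

Lemma jump_swap eta g : (0 < rate eta g)%N -> jump g eta = swap g eta.
Proof.
move=> cg; apply: configP => k; rewrite jumpE// swapE.
move: cg; rewrite rateE lt0b => /andP[ei ej].
case: tpermP => [->|->|/eqP/negPf-> /eqP/negPf->].
- rewrite eqxx andbF /= (negPf ej).
  by case: eqP => // e; rewrite -e ei in ej.
- by rewrite eqxx orbT ei.
- by rewrite andbT orbF.
Qed.

Lemma jump_permc s eta g :
  jump g (permc s eta) = permc s (jump (s g.1, s g.2) eta).
Proof.
have [cg|] := posnP (rate (permc s eta) g).
  rewrite jump_rate0// jump_rate0//; by rewrite -rate_permc.
move=> cg; apply: configP => k; rewrite permcE !jumpE//= -?rate_permc//.
by rewrite permcE !(inj_eq perm_inj).
Qed.

Lemma rate_rev eta g : (0 < rate eta g)%N -> rate (jump g eta) (g.2, g.1) = 1%N.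
Proof.
move=> cg; rewrite rateE/= !jumpE// eqxx orbT eqxx andbF/=.
move: cg; rewrite rateE lt0b => /andP[ei ej].
by case: eqP => // e; rewrite -e ei in ej.
Qed.

Lemma jumpK eta g : (0 < rate eta g)%N -> jump (g.2, g.1) (jump g eta) = eta.
Proof.
move=> cg; rewrite jump_swap ?rate_rev//= jump_swap//.
by apply: configP => k; rewrite !swapE tpermC tpermK.
Qed.

Context {R : realType}.

(** Relabelling the sites by [s] only relabels the moves, over all of which [gen] sums. *)
Lemma gen_permc (f : config L N -> R) s eta :
  gen f (permc s eta) = gen (f \o permc s) eta.
Proof.
rewrite /gen [RHS](reindex_inj (h := fun g => (s g.1, s g.2))); last first.
  by move=> [a b] [c d] /= [/perm_inj-> /perm_inj->].
by apply: eq_bigr => g _; rewrite rate_permc jump_permc.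
Qed.

Lemma sum_rate eta (F : move L -> R) :
  \sum_h (rate eta h)%:R * F h = \sum_(h | (0 < rate eta h)%N) F h.
Proof.
rewrite [RHS]big_mkcond; apply: eq_bigr => h _.
by rewrite rateE; case: (_ && _); rewrite ?mul1r ?mul0r.
Qed.

(** The possible moves ending at [g.2] correspond to the N occupied sites, those starting at [g.1]
    to the L - N vacant ones; [g] itself counts twice. *)
Lemma sum_rate_adjacent eta g : (N <= L)%N -> (0 < rate eta g)%N ->
  \sum_(h | (0 < rate eta h)%N) ((h.1 == g.1)%:R + (h.2 == g.2)%:R)
  = L%:R :> R.
Proof.
move=> NL; rewrite rateE lt0b -sum_rate => /andP[ei ej].
have -> : L%:R = (\sum_(k < L) eta k)%:R + (\sum_(k < L) (1 - eta k))%:R :> R.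
  by rewrite sum_occ sum_vac -natrD subnKC.
under eq_bigr => h do rewrite mulrDr.
rewrite big_split/= addrC; congr (_ + _).
  rewrite -(pair_big xpredT xpredT
    (fun a b => (rate eta (a, b))%:R * (b == g.2)%:R))/=.
  rewrite natr_sum; apply: eq_bigr => a _.
  rewrite (bigD1 g.2)//= eqxx mulr1 big1 ?addr0; last first.
    by move=> b /negPf->; rewrite mulr0.
  by rewrite rateE/= ej andbT.
rewrite -(pair_big xpredT xpredT
  (fun a b => (rate eta (a, b))%:R * (a == g.1)%:R))/=.
rewrite exchange_big natr_sum; apply: eq_bigr => b _.
rewrite (bigD1 g.1)//= eqxx mulr1 big1 ?addr0; last first.
  by move=> a /negPf->; rewrite mulr0.
by rewrite /rate/= ei mul1n.
Qed.

Lemma sum_Sset (F : config L N -> move L -> R) :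
  \sum_(x in Sset) (let: (eta, g) := x in F eta g) =
  \sum_eta \sum_(g | (0 < rate eta g)%N) F eta g.
Proof.
rewrite pair_big_dep/=; apply: eq_big => [[eta g]|[eta g]]//=.
by rewrite inE.
Qed.

(** Pairing each possible jump with its reverse is an involution of the set of possible jumps. *)
Lemma reversible (F : config L N -> config L N -> R) :
  \sum_eta \sum_(h | (0 < rate eta h)%N) F eta (jump h eta) =
  \sum_eta \sum_(h | (0 < rate eta h)%N) F (jump h eta) eta.
Proof.
pose rev (x : config L N * move L) := (jump x.2 x.1, (x.2.2, x.2.1)).
have revP x : (0 < rate x.1 x.2)%N -> (0 < rate (rev x).1 (rev x).2)%N.
  by move=> cx; rewrite rate_rev.
have revK x : (0 < rate x.1 x.2)%N -> rev (rev x) = x.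
  by case: x => eta [a b] /= cx; rewrite /rev/= (jumpK eta (a, b)).
rewrite !pair_big_dep [LHS](reindex_onto rev rev revK).
apply: eq_big => [x|x /andP[_ /eqP xK]]; last first.
  by congr F; rewrite -[LHS]/(rev (rev x)).1 xK.
apply/idP/idP => [/andP[cx /eqP xK]|cx].
  by rewrite -xK; exact: revP.
by apply/andP; split; [exact: revP|rewrite revK].
Qed.

End Moves.

(** * Curvature bounds for coupled jumps and their summation *)

Section Curvature.
Context {R : realType} {L N : nat} (theta : R * R -> R).
Context (theta_ge0 : forall s t : R, 0 < s -> 0 < t -> 0 <= theta (s, t)).
Context (theta_diff :
  forall s t : R, 0 < s -> 0 < t -> differentiable theta (s, t)).
Context (theta_concave : concave_on (@posquad R) theta).
Context (rho psi : config L N -> R) (rho_gt0 : forall eta, 0 < rho eta).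
Implicit Types (eta xi : config L N) (g h : move L).

Definition edge_weight g eta := theta (rho eta, rho (swap g eta)).

Definition edge_diff g eta := psi eta - psi (swap g eta).

(** What a commuting square leaves at the edge from [eta] to [swap g eta] after the concavity bound.
    It may be negative; only its symmetrization in [eta] and [xi] is a nonnegative multiple of a
    square. *)
Definition square_term g eta xi : R :=
  4^-1 * (edge_weight g xi * edge_diff g eta ^+ 2
          + edge_weight g eta * edge_diff g eta ^+ 2
          - 2 * edge_weight g eta * edge_diff g eta * edge_diff g xi).

(* The left-hand side merges the cases of the coupled jump: [h] disjoint from
   [g] (first term only), [h] sharing one endpoint with [g], and [h = g]. *)
Lemma coupled_jump_ge eta g h : (0 < rate eta g)%N -> (0 < rate eta h)%N ->
  (rate (jump h eta) g)%:R * square_term g eta (jump h eta)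
  + ((h.1 == g.1)%:R + (h.2 == g.2)%:R) / 4
    * (edge_weight g eta * edge_diff g eta ^+ 2)
  + (h == g)%:R * Mtheta theta / 2
    * (edge_weight g eta * edge_diff g eta ^+ 2) <=
  4^-1 * (partial1 theta (rho eta) (rho (swap g eta))
            * (rho (jump h eta) - rho eta)
        + partial2 theta (rho eta) (rho (swap g eta))
            * (rho (swap g (jump h eta)) - rho (swap g eta)))
    * edge_diff g eta ^+ 2
  - 2^-1 * edge_weight g eta * edge_diff g eta
    * (edge_diff g (jump h eta) - edge_diff g eta).
Proof.
move=> cg ch; set xi := jump h eta.
have grad s t := concave_le_diff _ theta_diff theta_concave (rho eta)
  (rho (swap g eta)) s t (rho_gt0 _) (rho_gt0 _).
have sqd : 0 <= edge_diff g eta ^+ 2 by exact: sqr_ge0.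
have w0 : 0 <= edge_weight g eta by exact: theta_ge0.
have gi : eta g.1 by move: cg; rewrite rateE lt0b => /andP[].
have gj : eta g.2 = false.
  by move: cg; rewrite rateE lt0b => /andP[_ /negbTE].
have hj : eta h.2 = false.
  by move: ch; rewrite rateE lt0b => /andP[_ /negbTE].
have gji : (g.1 == h.2) = false.
  by apply/negbTE/eqP => e; rewrite e hj in gi.
have xi1 : xi g.1 = (h.1 != g.1) by rewrite jumpE// gi gji orbF eq_sym.
have xi2 : xi g.2 = (h.2 == g.2) by rewrite jumpE// gj/= eq_sym.
have -> : (h == g) = (h.1 == g.1) && (h.2 == g.2) by [].
have cxi : rate xi g = (h.1 != g.1) && (h.2 != g.2) :> nat.
  by rewrite rateE xi1 xi2.
(* If exactly one endpoint of [h] agrees with that of [g], then the sites of [g]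
   are both empty or both full in [xi]. *)
have fixed : (h.1 == g.1) != (h.2 == g.2) -> swap g xi = xi.
  move=> ne; apply: configP => k; rewrite permcE.
  have e : xi g.1 = xi g.2.
    by rewrite xi1 xi2; move: ne; case: (h.1 == _); case: (h.2 == _).
  by case: tpermP => [->|->|]; rewrite ?e.
(* After merging, the tangent plane is compared with the diagonal point [(rho xi, rho xi)], where
   [theta] is at least 0. *)
have edge_bound : swap g xi = xi -> - edge_weight g eta <=
    partial1 theta (rho eta) (rho (swap g eta)) * (rho xi - rho eta)
  + partial2 theta (rho eta) (rho (swap g eta)) * (rho xi - rho (swap g eta)).
  move=> e; have := grad (rho xi) (rho xi) (rho_gt0 _) (rho_gt0 _).
  have := theta_ge0 (rho xi) (rho xi) (rho_gt0 _) (rho_gt0 _).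
  by rewrite /edge_weight; lra.
rewrite cxi; case: (eqVneq h.1 g.1) fixed => e1;
  case: (eqVneq h.2 g.2) => e2 //= fixed.
(* Trading places: the tangent bounds at the two diagonal points add up to [theta (s, s) + theta (t,
   t) - 2 * theta (s, t)], which [Mtheta_le] controls. *)
- have hg : h = g by apply/eqP; rewrite -pair_eqE /pair_eq/= e1 e2 !eqxx.
  have xiE : xi = swap g eta by rewrite /xi hg jump_swap.
  have xiK : swap g xi = eta by rewrite xiE swapK.
  have -> : edge_diff g xi = - edge_diff g eta.
    by rewrite /edge_diff xiK xiE opprB.
  have Mle := Mtheta_le _ theta_ge0 (rho eta) (rho (swap g eta))
    (rho_gt0 _) (rho_gt0 _).
  rewrite xiK xiE.
  have := grad (rho eta) (rho eta) (rho_gt0 _) (rho_gt0 _).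
  have := grad (rho (swap g eta)) (rho (swap g eta)) (rho_gt0 _) (rho_gt0 _).
  rewrite !subrr !mulr0 addr0 add0r -/(edge_weight g eta).
  move: Mle; rewrite -/(edge_weight g eta).
  set p1 := partial1 _ _ _ * _; set p2 := partial2 _ _ _ * _ => Mle p1P p2P.
  have : (2 * Mtheta theta * edge_weight g eta - 2 * edge_weight g eta)
      * edge_diff g eta ^+ 2 <= (p1 + p2) * edge_diff g eta ^+ 2.
    by apply: ler_wpM2r => //; lra.
  lra.
(* Merging: [edge_diff g xi] is 0, so the second term gains 1/2, of which concavity costs 1/4. *)
1,2: have xiK := fixed isT; have := edge_bound xiK;
  rewrite /edge_diff xiK subrr -/(edge_diff g eta) => /(ler_wpM2r sqd); lra.
(* Square: the tangent plane is compared with the opposite edge, from [xi] to [swap g xi]. *)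
- have := grad (rho xi) (rho (swap g xi)) (rho_gt0 _) (rho_gt0 _).
  rewrite -/(edge_weight g eta) -/(edge_weight g xi) /square_term.
  move=> /(ler_wpM2r sqd); lra.
Qed.

Lemma square_term_sym g eta xi :
  square_term g eta xi + square_term g xi eta =
  4^-1 * (edge_weight g eta + edge_weight g xi)
  * (edge_diff g eta - edge_diff g xi) ^+ 2.
Proof. by rewrite /square_term; ring. Qed.

Lemma sum_square_term_ge0 g :
  0 <= \sum_eta \sum_(h | (0 < rate eta h)%N)
    (rate eta g)%:R * (rate (jump h eta) g)%:R
    * square_term g eta (jump h eta).
Proof.
pose F eta xi := (rate eta g)%:R * (rate xi g)%:R * square_term g eta xi.
(* The sum is doubled and one copy reversed, which pairs each square term with its mirror image; the
   product of the two rates is symmetric. *)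
rewrite -(pmulrn_lge0 _ (ltn0Sn 1)) mulr2n {1}(reversible F).
rewrite -big_split sumr_ge0// => eta _ /=.
rewrite -big_split sumr_ge0// => h _ /=.
rewrite /F [X in X * _ + _]mulrC -mulrDr addrC square_term_sym.
apply: mulr_ge0; first exact: mulr_ge0.
apply: mulr_ge0; last exact: sqr_ge0.
by apply: mulr_ge0 => //; apply: addr_ge0; exact: theta_ge0.
Qed.

Lemma curvature_density_ge eta g : (N <= L)%N -> (0 < rate eta g)%N ->
  (Mtheta theta + L%:R / 2) / 2 * (edge_weight g eta * edge_diff g eta ^+ 2)
  + \sum_(h | (0 < rate eta h)%N)
      (rate (jump h eta) g)%:R * square_term g eta (jump h eta) <=
  4^-1 * (partial1 theta (rho eta) (rho (jump g eta)) * gen rho eta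
          + partial2 theta (rho eta) (rho (jump g eta)) * gen rho (jump g eta))
    * edge_diff g eta ^+ 2
  - 2^-1 * edge_weight g eta * edge_diff g eta
    * (gen psi eta - gen psi (jump g eta)).
Proof.
(* Both generators become sums over the jumps [h] of [eta], so the bound can be proved one [h] at a
   time. *)
move=> NL cg; rewrite jump_swap// !gen_permc.
have genD (f f' : config L N -> R) : gen f eta - gen f' eta =
    gen (fun xi => f xi - f' xi) eta.
  by rewrite /gen -sumrB; apply: eq_bigr => h _; ring.
rewrite genD -/(edge_diff g) /gen !sum_rate !mulr_sumr -big_split/=.
rewrite mulr_sumr mulr_suml -sumrB.
have adj := sum_rate_adjacent eta g NL cg.
have sumg : \sum_(h | (0 < rate eta h)%N) (h == g)%:R = 1 :> R.
  by rewrite (bigD1 g)//= eqxx big1 ?addr0// => h /andP[_ /negPf->].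
set W := edge_weight g eta * _.
(* The endpoint count L with weight 1/4 gives L/4; the single move [h = g] gives M/2. *)
have -> : (Mtheta theta + L%:R / 2) / 2 * W =
    \sum_(h | (0 < rate eta h)%N) (((h.1 == g.1)%:R + (h.2 == g.2)%:R) / 4 * W
      + (h == g)%:R * Mtheta theta / 2 * W).
  by rewrite big_split/= -!mulr_suml adj sumg; field.
rewrite -big_split/=; apply: ler_sum => h ch.
have := coupled_jump_ge eta g h cg ch; rewrite -/W.
by rewrite /=; lra.
Qed.

End Curvature.

Theorem theorem4p5 (R : realType) (L N : nat) (NL : (N < L)%N)
    (theta : R * R -> R)
    (theta_ge0 : forall s t : R, 0 < s -> 0 < t -> 0 <= theta (s, t))
    (theta_neq0 : exists s t : R, [/\ 0 < s, 0 < t & theta (s, t) != 0])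
    (theta_sym : forall s t : R, 0 < s -> 0 < t -> theta (s, t) = theta (t, s))
    (theta_diff : forall s t : R, 0 < s -> 0 < t -> differentiable theta (s, t))
    (theta_concave : concave_on (@posquad R) theta)
    (rho psi : config L N -> R) (rho_gt0 : forall eta, 0 < rho eta) :
  calB theta rho psi >= (Mtheta theta + L%:R / 2) * calA theta rho psi.
Proof.
rewrite /calB /calA /calC /calD !sum_Sset.
rewrite mulrA !mulr_sumr -sumrB -subr_ge0 -sumrB.
(* The square terms are inserted with [g] outermost, since they are nonnegative only after summation
   over [eta]; the sums are then exchanged to compare at fixed [eta] and [g]. *)
apply: (@le_trans _ _ (\sum_(g : move L) \sum_(eta : config L N)
  \sum_(h | (0 < rate eta h)%N) #|{: config L N}|%:R^-1 *
    ((rate eta g)%:R * (rate (jump h eta) g)%:R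
     * square_term theta rho psi g eta (jump h eta)))).
  apply: sumr_ge0 => g _; under eq_bigr do rewrite -mulr_sumr.
  by rewrite -mulr_sumr mulr_ge0// ?invr_ge0// sum_square_term_ge0.
rewrite exchange_big/=; apply: ler_sum => eta _.
rewrite !mulr_sumr -!sumrB [leRHS]big_mkcond/=; apply: ler_sum => g _.
case: ifPn => [cg|]; last first.
  by rewrite -eqn0Ngt => /eqP->; rewrite big1// => h _; rewrite !mul0r mulr0.
have c1 : rate eta g = 1%N.
  by move: cg; rewrite rateE; case: (_ && _).
have := curvature_density_ge theta theta_ge0 theta_diff theta_concave rho psi
  rho_gt0 eta g (ltnW NL) cg.
rewrite c1; under eq_bigr do rewrite mul1r.
rewrite -mulr_sumr -/(unif eta) jump_swap//.
have u0 : 0 <= unif eta :> R by rewrite invr_ge0.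
move=> /(ler_wpM2l u0); rewrite /edge_weight /edge_diff.
lra.
Qed.
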